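(* Let $\mu_A$ be a Radon measure on $(\ell,r)$ such that $\mu_A((\ell,r))>0$ and consider the integral equations $$g(x)=a+\kappa\,(s(x)-s(\ell))+\int_\ell^r(s(x)-s(y))^+g(y)\,\mu_A(dy),\qquad(\mathrm{I})$$ $$g(x)=a+\kappa\,(s(r)-s(x))+\int_\ell^r(s(y)-s(x))^+g(y)\,\mu_A(dy).\qquad(\mathrm{II})$$ (1) If for some $b\in(\ell,r)$ $$\int_\ell^b(s(b)-s(y))\,\mu_A(dy)<\infty\quad\Big(\text{resp. }\int_b^r(s(y)-s(b))\,\mu_A(dy)<\infty\Big),$$ there exists a non-negative nondecreasing (resp. nonincreasing) solution to (I) (resp. (II)) for $a>0$ and $\kappa=0$. Moreover, under this condition a solution with the same properties exists for $a>0$, $\kappa>0$ if one further assumes that $s(\ell)$ (resp. $s(r)$) is finite. (2) If $s(\ell)$ (resp. $s(r)$) is finite and for some $b\in(\ell,r)$ $$\int_\ell^b(s(y)-s(\ell))\,\mu_A(dy)<\infty\quad\Big(\text{resp. }\int_b^r(s(r)-s(y))\,\mu_A(dy)<\infty\Big),$$ there exists a non-negative nondecreasing (resp. nonincreasing) solution to (I) (resp. (II)) for $a=0$ and $\kappa>0$.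
   Context: $-\infty\le\ell<r\le\infty$, and $s$ is the strictly increasing continuous scale function on $(\ell,r)$ of a regular one-dimensional diffusion $X$ on $(\ell,r)$ with no killing inside $(\ell,r)$ and absorbing boundaries; $s$ is extended to $\ell,r$ by limits (possibly infinite). Convention: $0\times\infty=0$. Solutions are real-valued functions on $(\ell,r)$, implicitly assumed to make the integral absolutely convergent for every $x\in(\ell,r)$. *)

(* Defs.v *)
From HB Require Import structures.
From mathcomp Require Import all_boot all_order all_algebra.
From mathcomp Require Import all_classical all_reals all_analysis.

Set Implicit Arguments.
Unset Strict Implicit.
Unset Printing Implicit Defensive.

Import Order.TTheory GRing.Theory Num.Theory.
Import numFieldNormedType.Exports.

Local Open Scope classical_set_scope.
Local Open Scope ring_scope.

(* The real interval (l, r), whose endpoints may be infinite. *)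
Definition state_space (R : realType) (l r : \bar R) : set R :=
  [set x : R | (l < x%:E)%E /\ (x%:E < r)%E].

(* The scale functions of regular diffusions on (l, r) without killing are
   exactly the functions satisfying this predicate.  The values of s outside
   (l, r) are irrelevant. *)
Definition is_scale_function (R : realType) (l r : \bar R) (s : R -> R) : Prop :=
  {in state_space l r &, {homo s : x y / x < y}} /\
  {in state_space l r, continuous s}.

(* Filters of real points tending to l from the right, and to r from the left.
   The last branch of each match is vacuous when l < r. *)
Definition near_left_end (R : realType) (l : \bar R) : set_system R :=
  match l with
  | a%:E => at_right a
  | -oo%E => ninfty_nbhs R
  | +oo%E => pinfty_nbhs R
  end.

Definition near_right_end (R : realType) (r : \bar R) : set_system R :=
  match r with
  | a%:E => at_left a
  | +oo%E => pinfty_nbhs R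
  | -oo%E => ninfty_nbhs R
  end.

(* s(l) and s(r) *)
Definition scale_left (R : realType) (l : \bar R) (s : R -> R) : \bar R :=
  lim ((s x)%:E @[x --> near_left_end l]).

Definition scale_right (R : realType) (r : \bar R) (s : R -> R) : \bar R :=
  lim ((s x)%:E @[x --> near_right_end r]).

(* A measure on (l, r) is represented by a Borel measure on R of which only the
   restriction to (l, r) is ever used. *)
Definition is_radon (R : realType) (l r : \bar R)
    (mu : {measure set (measurableTypeR R) -> \bar R}) : Prop :=
  forall K : set R, compact K -> K `<=` state_space l r -> (mu K < +oo)%E.

(* In both equations the product with kappa is taken in \bar R, where
   0 * +oo = 0, so that kappa = 0 is meaningful when s(l) or s(r) is infinite. *)
Definition solves_I (R : realType) (l r : \bar R) (s : R -> R)
    (mu : {measure set (measurableTypeR R) -> \bar R}) (a kappa : R)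
    (g : R -> R) : Prop :=
  forall x : R, x \in state_space l r ->
    mu.-integrable (state_space l r)
      (fun y => (Num.max (s x - s y) 0 * g y)%:E) /\
    ((g x)%:E = a%:E + kappa%:E * ((s x)%:E - scale_left l s) +
      \int[mu]_(y in state_space l r) (Num.max (s x - s y) 0 * g y)%:E)%E.

Definition solves_II (R : realType) (l r : \bar R) (s : R -> R)
    (mu : {measure set (measurableTypeR R) -> \bar R}) (a kappa : R)
    (g : R -> R) : Prop :=
  forall x : R, x \in state_space l r ->
    mu.-integrable (state_space l r)
      (fun y => (Num.max (s y - s x) 0 * g y)%:E) /\
    ((g x)%:E = a%:E + kappa%:E * (scale_right r s - (s x)%:E) +
      \int[mu]_(y in state_space l r) (Num.max (s y - s x) 0 * g y)%:E)%E.

Definition has_nonneg_nondecreasing_solution_I (R : realType) (l r : \bar R)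
    (s : R -> R) (mu : {measure set (measurableTypeR R) -> \bar R})
    (a kappa : R) : Prop :=
  exists g : R -> R,
    [/\ solves_I l r s mu a kappa g,
        {in state_space l r, forall x, 0 <= g x} &
        {in state_space l r &, {homo g : x y / x <= y}}].

Definition has_nonneg_nonincreasing_solution_II (R : realType) (l r : \bar R)
    (s : R -> R) (mu : {measure set (measurableTypeR R) -> \bar R})
    (a kappa : R) : Prop :=
  exists g : R -> R,
    [/\ solves_II l r s mu a kappa g,
        {in state_space l r, forall x, 0 <= g x} &
        {in state_space l r &, {homo g : x y /~ x <= y}}].

(* Main.v *)
Require Import Defs.
From HB Require Import structures.
From mathcomp Require Import all_boot all_order all_algebra.
From mathcomp Require Import all_classical all_reals all_analysis.
From mathcomp Require Import measurable_realfun ring lra.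

Set Implicit Arguments.
Unset Strict Implicit.
Unset Printing Implicit Defensive.

Import Order.TTheory GRing.Theory Num.Theory.
Import numFieldNormedType.Exports.

Local Open Scope classical_set_scope.
Local Open Scope ring_scope.

(** Put [t = s] for equation (I) and [t = - s] for equation (II).  Both then read
[g x = phi (t x) + \int (t x - t y)^+ g y mu(dy)] with [phi] nonnegative and
nondecreasing: a Volterra equation, since the value at [x] involves only points
of strictly lower level.  Its solutions are sought as functions [v] of the level
[t x].

The Picard iterates started at 0 increase, and by monotone convergence their
limit [v] is a nonnegative nondecreasing solution with values in [0, +oo].  The
whole point is finiteness, which follows from a supersolution below each level
[q = t x] ([minimal_volterra_solution]).  The supersolution is a multiple of
[h c * exp (lam * max c p)], where [h] is adapted to the data: [h = 1] when
[phi] is merely bounded below [q] (all cases with [a > 0]), and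
[h c = (c - theta)^+] when [phi] is proportional to the distance to the lower end
[theta] of the scale ([a = 0]).  The integrability hypothesis is exactly what
makes the part of the kernel below a low level [p] negligible, uniformly after
division by [h] ([volterra_tail]); above [p] the measure is finite and a large
[lam] makes the exponential decay dominate.  The operator thus has norm at most
1/2 for this weight ([weighted_volterra_le]), so a supersolution exists
([volterra_supersolution]).

It remains to see that the values of the scale at the endpoints, which are
defined as limits, are strict bounds for [s] ([scale_left_lt],
[scale_right_gt]), and that the set of points between two levels is a compact segment,
so that the Radon property applies ([radon_scale], [radon_scaleN]). *)

Lemma nondecreasing_emeasurable (R : realType) (u : R -> \bar R) :
  {homo u : x y / x <= y >-> (x <= y)%E} -> measurable_fun [set: R] u.
Proof.
move=> u_nd; apply: (measurability _ (ErealGenCInfty.measurableE R)).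
move=> /= _ [_ [x ->] <-]; rewrite setTI.
apply: is_interval_measurable => a b /=.
rewrite !in_itv/= !andbT => ua ub c /andP[ac cb].
by rewrite in_itv/= andbT (le_trans ua)// u_nd.
Qed.

(** * Volterra equations driven by a real function *)

Section volterra.
Context d (T : measurableType d) (R : realType).
Variables (mu : {measure set T -> \bar R}) (E : set T) (t : T -> R).
Hypotheses (mE : measurable E) (mt : measurable_fun E t).
Local Open Scope ereal_scope.

(** The unknown is a function [u] of the level [c = t y] instead of a function
of [y]: this makes the operator act on nondecreasing functions of a real
variable, whose measurability is automatic. *)
Definition volterra (u : R -> \bar R) (c : R) : \bar R :=
  \int[mu]_(y in E) ((Num.max (c - t y) 0)%:E * u (t y)).

(** Solutions are required to be monotone along [t] and not along a given
order of [T]: for a decreasing [t] this turns into the opposite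
monotonicity of the solutions of (II). *)
Definition has_volterra_solution (phi : R -> R) :=
  exists g : T -> R,
    [/\ forall x, E x ->
          mu.-integrable E (fun y => (Num.max (t x - t y) 0 * g y)%:E) /\
          (g x)%:E = (phi (t x))%:E +
            \int[mu]_(y in E) (Num.max (t x - t y) 0 * g y)%:E,
        forall x, E x -> (0 <= g x)%R &
        forall x y, E x -> E y -> (t x <= t y)%R -> (g x <= g y)%R].

Let mcomp (u : R -> \bar R) : measurable_fun [set: R] u ->
  measurable_fun E (u \o t).
Proof. by move=> mu'; apply: (measurableT_comp mu' mt). Qed.

Lemma measurable_volterra_kernel (c : R) :
  measurable_fun E (fun y => (Num.max (c - t y) 0)%:E).
Proof.
apply/measurable_EFinP; apply: measurable_maxr => //.
by apply: measurable_funB.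
Qed.

Lemma measurable_volterra_integrand (u : R -> \bar R) (c : R) :
  measurable_fun [set: R] u ->
  measurable_fun E (fun y => (Num.max (c - t y) 0)%:E * u (t y)).
Proof.
move=> mu'; apply: emeasurable_funM; first exact: measurable_volterra_kernel.
exact: mcomp.
Qed.

Lemma volterra_kernel_ge0 (c x : R) : 0 <= (Num.max (c - x) 0)%:E.
Proof. by rewrite lee_fin le_max lexx orbT. Qed.

Lemma volterra_ge0 (u : R -> \bar R) (c : R) :
  (forall x, 0 <= u x) -> 0 <= volterra u c.
Proof.
by move=> u0; apply: integral_ge0 => y _; rewrite mule_ge0// volterra_kernel_ge0.
Qed.

(** The kernel increases with [c], so the Picard iterates below stay
nondecreasing, hence measurable. *)
Lemma volterra_nondecreasing (u : R -> \bar R) :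
  measurable_fun [set: R] u -> (forall x, 0 <= u x) ->
  {homo volterra u : c c' / (c <= c')%R >-> c <= c'}.
Proof.
move=> mu' u0 c c' cc'; apply: ge0_le_integral => //.
- by move=> y _; rewrite mule_ge0// volterra_kernel_ge0.
- exact: measurable_volterra_integrand.
- exact: measurable_volterra_integrand.
- move=> y _; rewrite lee_wpmul2r// lee_fin.
  by rewrite ge_max !le_max lexx !orbT lerD2r cc'.
Qed.

(** The kernel vanishes for [t y >= c]; this locality is what allows a bound
for the solution below a level to be obtained from data below that level. *)
Lemma le_volterra (u v : R -> \bar R) (c : R) :
  measurable_fun [set: R] u -> measurable_fun [set: R] v ->
  (forall x, 0 <= u x) ->
  (forall y, E y -> (t y < c)%R -> u (t y) <= v (t y)) ->
  volterra u c <= volterra v c.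
Proof.
move=> mu' mv u0 uv; apply: ge0_le_integral => //.
- by move=> y _; rewrite mule_ge0// volterra_kernel_ge0.
- exact: measurable_volterra_integrand.
- exact: measurable_volterra_integrand.
- move=> y Ey; have [tyc|cty] := ltP (t y) c.
    by rewrite lee_wpmul2l ?volterra_kernel_ge0// uv.
  by rewrite max_r ?subr_le0// !mul0e.
Qed.

(** * The minimal solution and the comparison principle *)

Section minimal_solution.
Variable phi : R -> R.
Hypotheses (phi0 : forall c, (0 <= phi c)%R)
  (phi_nd : {homo phi : c c' / (c <= c')%R}).

Let step (u : R -> \bar R) (c : R) := (phi c)%:E + volterra u c.
Let u_ n := iter n step (cst 0).

Let good (u : R -> \bar R) :=
  (forall x, 0 <= u x) /\ {homo u : c c' / (c <= c')%R >-> c <= c'}.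

Let good_step u : good u -> good (step u).
Proof.
move=> [u0 und]; split => [x|c c' cc'].
  by rewrite adde_ge0 ?lee_fin// volterra_ge0.
apply: leeD; first by rewrite lee_fin phi_nd.
by apply: volterra_nondecreasing => //; exact: nondecreasing_emeasurable.
Qed.

Let good_u n : good (u_ n).
Proof. by elim: n => [|n ih]; [split|exact: good_step]. Qed.

Let mu_ n : measurable_fun [set: R] (u_ n).
Proof. by apply: nondecreasing_emeasurable; have [] := good_u n. Qed.

Let u_S n x : u_ n x <= u_ n.+1 x.
Proof.
elim: n x => [x|n ih x]; first exact: (good_u 1).1.
apply: leeD => //; apply: (le_volterra (mu_ n) (mu_ n.+1) (good_u n).1) => //.
Qed.

Let u_nd x : nondecreasing_seq (u_ ^~ x).
Proof. by apply/nondecreasing_seqP => n; exact: u_S. Qed.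

Let cvg_u x : cvgn (u_ ^~ x).
Proof. exact: ereal_nondecreasing_is_cvgn. Qed.

Let v x := limn (u_ ^~ x).

Let v0 x : 0 <= v x.
Proof. by apply: lime_ge => //; apply: nearW => n; exact: (good_u n).1. Qed.

Let v_homo : {homo v : c c' / (c <= c')%R >-> c <= c'}.
Proof.
move=> c c' cc'; apply: lee_lim => //; apply: nearW => n.
by have [_ ->] := good_u n.
Qed.

Let mv : measurable_fun [set: R] v.
Proof. exact: nondecreasing_emeasurable. Qed.

(* Monotone convergence gives the equation with values in [0, +oo]. *)
Let vE c : v c = (phi c)%:E + volterra v c.
Proof.
have mono : volterra (u_ n) c @[n --> \oo] --> volterra v c.
  rewrite /volterra.
  rewrite (_ : \int[mu]_(y in E) _ = \int[mu]_(y in E)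
      (limn (fun n => (Num.max (c - t y) 0)%:E * u_ n (t y)))).
    apply: cvg_monotone_convergence => //.
    - by move=> n; exact: measurable_volterra_integrand.
    - move=> n y _; rewrite mule_ge0 ?volterra_kernel_ge0//.
      exact: (good_u n).1.
    - by move=> y _ m n mn; rewrite lee_wpmul2l ?volterra_kernel_ge0// u_nd.
  apply: eq_integral => y _; apply/esym/cvg_lim => //.
  by apply: cvgeZl => //; exact: cvg_u.
apply/cvg_lim => //.
rewrite -cvg_shiftS.
by apply: cvgeD => //; exact: cvg_cst.
Qed.

(** The increasing limit [v] of the Picard iterates started at 0 solves the
equation with values in [0, +oo].  Every supersolution below the level [t x]
dominates all iterates there by induction, so its existence makes [v (t x)]
finite.  The supersolution may change with [x], as it serves only as a
bound. *)
Lemma minimal_volterra_solution :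
  (forall x, E x -> exists2 psi : R -> R,
     measurable_fun [set: R] psi /\ (forall c, (0 <= psi c)%R) &
     forall c, (c <= t x)%R ->
       (phi c)%:E + volterra (EFin \o psi) c <= (psi c)%:E) ->
  has_volterra_solution phi.
Proof.
move=> super.
have v_fin x : E x -> v (t x) \is a fin_num.
  move=> Ex; have [psi [mpsi psi0] psiP] := super x Ex.
  have mEpsi : measurable_fun [set: R] (EFin \o psi) by exact/measurable_EFinP.
  have u_le n c : (c <= t x)%R -> u_ n c <= (psi c)%:E.
    elim: n c => [c _|n ih c cx]; first by rewrite lee_fin.
    apply: le_trans (psiP c cx); apply: leeD => //.
    apply: (le_volterra (mu_ n) mEpsi (good_u n).1).
    by move=> y Ey tyc; rewrite ih// (le_trans (ltW tyc)).
  rewrite ge0_fin_numE// (@le_lt_trans _ _ (psi (t x))%:E) ?ltry//.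
  by apply: lime_le => //; apply: nearW => n; exact: u_le.
have gE x : E x -> (fine (v (t x)))%:E = v (t x).
  by move=> Ex; rewrite fineK// v_fin.
have kgE x y : y \in E -> (Num.max (t x - t y) 0 * fine (v (t y)))%:E =
    (Num.max (t x - t y) 0)%:E * v (t y).
  by rewrite inE => Ey; rewrite EFinM gE.
have intE x : \int[mu]_(y in E) (Num.max (t x - t y) 0 * fine (v (t y)))%:E =
    volterra v (t x).
  by apply: eq_integral => y yE; rewrite kgE.
exists (fine \o v \o t); split => [x Ex|x Ex|x y Ex Ey xy] /=.
- split; last by rewrite gE// vE intE.
  apply: (eq_integrable mE (fun y => (Num.max (t x - t y) 0)%:E * v (t y))).
    by move=> y yE; rewrite kgE.
  apply/integrableP; split; first exact: measurable_volterra_integrand.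
  under eq_integral do rewrite gee0_abs ?mule_ge0 ?volterra_kernel_ge0//.
  apply: (@le_lt_trans _ _ (v (t x))).
    by rewrite [leRHS]vE leeDr// lee_fin.
  by rewrite -ge0_fin_numE// v_fin.
- exact/fine_ge0.
- by rewrite fine_le ?v_fin// v_homo.
Qed.

End minimal_solution.

Let mlt (a : R) : measurable [set c : R | (c < a)%R].
Proof. by rewrite -set_itvNyo. Qed.

Let mle (a : R) : measurable [set c : R | (c <= a)%R].
Proof. by rewrite -set_itvNyc. Qed.

Let mge (a : R) : measurable [set c : R | (a <= c)%R].
Proof. by rewrite -set_itvcy. Qed.

Let mgt (a : R) : measurable [set c : R | (a < c)%R].
Proof. by rewrite -set_itvoy. Qed.

Let lvl (A : set R) : measurable A -> measurable (E `&` t @^-1` A).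
Proof. by move=> mA; apply: mt. Qed.

(** * Supersolutions from an exponential weight *)

Lemma weight_nondecreasing (h : R -> R) (lam p : R) : (0 <= lam)%R ->
  (forall c, 0 <= h c)%R -> {homo h : c c' / (c <= c')%R} ->
  {homo (fun c => h c * expR (lam * Num.max c p))%R : c c' / (c <= c')%R}.
Proof.
move=> lam0 h0 h_nd x y xy; rewrite ler_pM ?expR_ge0 ?h_nd// ler_expR.
by rewrite ler_wpM2l// ge_max !le_max xy lexx orbT.
Qed.

(** The operator is a contraction for the weight [psi].  The part of the
integral over levels below [p] is at most a quarter of [psi c], by the bound on
the integral of [rho] and the monotonicity of the weight.  On levels in [p, q)
the weight is a true exponential, and [(c - z) * exp (- lam * (c - z))] is at
most [1 / lam]; there the mass is at most [N], and the choice of [lam] makes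
[N / lam] smaller than a quarter.  The exponent is frozen below [p] so that
[psi] stays bounded below by a multiple of [h] even when [t] is unbounded
below. *)
Lemma weighted_volterra_le (h rho : R -> R) (p q N : R) :
  (forall c, 0 <= h c)%R -> {homo h : c c' / (c <= c')%R} ->
  measurable_fun [set: R] rho ->
  (forall y, E y -> (t y < q)%R -> (0 <= rho (t y))%R) ->
  (forall y c, E y -> (t y < c <= q)%R ->
     ((c - t y) * h (t y) <= rho (t y) * h c)%R) ->
  \int[mu]_(y in E `&` t @^-1` [set c | c < q /\ c < p]%R) (rho (t y))%:E <=
    (4^-1)%:E ->
  mu (E `&` t @^-1` [set c | c < q /\ p <= c]%R) <= N%:E ->
  let psi c := (h c * expR ((4 * N + 1) * Num.max c p))%R in
  forall c, (c <= q)%R -> volterra (EFin \o psi) c <= (psi c / 2)%:E.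
Proof.
move=> h0 h_nd mrho rho0 hrho tail massN psi c cq.
set A := _ `&` t @^-1` _ in tail; set B := _ `&` t @^-1` _ in massN.
have N0 : (0 <= N)%R by rewrite -lee_fin (le_trans _ massN).
set lam := (4 * N + 1)%R in psi *.
have lam0 : (0 < lam)%R by rewrite /lam; lra.
have psi0 x : (0 <= psi x)%R by rewrite mulr_ge0// expR_ge0.
have mA : measurable A by apply: lvl; exact: (measurableI _ _ (mlt q) (mlt p)).
have mB : measurable B by apply: lvl; exact: (measurableI _ _ (mlt q) (mge p)).
have mpsi : measurable_fun [set: R] (EFin \o psi).
  apply/measurable_EFinP; apply: nondecreasing_measurable => //.
  exact: weight_nondecreasing (ltW lam0) h0 h_nd.
set f := fun y => (Num.max (c - t y) 0)%:E * (psi (t y))%:E.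
have mf : measurable_fun E f by exact: (measurable_volterra_integrand c mpsi).
have f0 y : 0 <= f y by rewrite mule_ge0 ?volterra_kernel_ge0 ?lee_fin.
have AB : A `|` B = E `&` t @^-1` [set x | (x < q)%R].
  rewrite /A /B -setIUr; congr (_ `&` _); apply/seteqP; split => y /=.
    by case=> -[].
  by move=> yq; case: (ltP (t y) p) => ?; [left|right].
have -> : volterra (EFin \o psi) c = \int[mu]_(y in A `|` B) f y.
  rewrite AB integral_mkcondr; apply: eq_integral => y _.
  rewrite /f /patch; case: ifPn => //; rewrite notin_setE /= => /negP.
  by rewrite -leNgt => qy; rewrite max_r ?mul0e// subr_le0 (le_trans cq).
rewrite ge0_integral_setU//; last 2 first.
- by apply: measurable_funS mf => // y; rewrite AB => -[].
- apply/disj_setPS => y; rewrite /A /B => -[[_ [_ /= yp]] [_ [_ /= py]]].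
  by move: (le_lt_trans py yp); rewrite ltxx.
(* Levels below p: the exponential factor only helps, by monotonicity. *)
have hA : \int[mu]_(y in A) f y <= (psi c)%:E * (4^-1)%:E.
  have mrhoA : measurable_fun A (fun y => (rho (t y))%:E).
    apply/measurable_EFinP; apply: measurable_funS mE _ _; first by move=> y [].
    exact: measurableT_comp mrho mt.
  apply: (@le_trans _ _ (\int[mu]_(y in A) ((psi c)%:E * (rho (t y))%:E))).
    apply: ge0_le_integral => //.
    - by apply: measurable_funS mf => // y [].
    - exact: measurable_funeM.
    move=> y [Ey [/= yq yp]]; rewrite /f -!EFinM lee_fin.
    case: (ltP (t y) c) => yc; last first.
      by rewrite max_r ?subr_le0// mul0r mulr_ge0// rho0.
    rewrite max_l ?subr_ge0 ?(ltW yc)// /psi mulrA [leRHS]mulrAC.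
    apply: ler_pM => //; rewrite ?expR_ge0//.
    - by rewrite mulr_ge0// subr_ge0 ltW.
    - by rewrite [leRHS]mulrC hrho// yc.
    - rewrite ler_expR ler_pM2l// ge_max !le_max lexx orbT andbT.
      by rewrite (ltW yc).
  rewrite ge0_integralZl_EFin//; last by move=> y [Ey [/= yq _]]; rewrite lee_fin rho0.
  by rewrite lee_wpmul2l// lee_fin.
(* Levels in [p, q): the decay of the exponential beats the mass N. *)
have hB : \int[mu]_(y in B) f y <= (psi c / lam)%:E * N%:E.
  apply: (@le_trans _ _ (\int[mu]_(y in B) cst ((psi c / lam)%:E) y)).
    apply: ge0_le_integral => //.
    - by apply: measurable_funS mf => // y [].
    move=> y [Ey [/= yq py]]; rewrite /f -!EFinM lee_fin.
    case: (ltP (t y) c) => yc; last first.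
      by rewrite max_r ?subr_le0// mul0r divr_ge0// ltW.
    rewrite max_l ?subr_ge0 ?(ltW yc)// /psi (max_l py).
    rewrite (max_l (ltW (le_lt_trans py yc))).
    rewrite mulrCA -mulrA; apply: ler_pM => //.
    - by rewrite mulr_ge0 ?expR_ge0// subr_ge0 ltW.
    - by rewrite h_nd// ltW.
    rewrite ler_pdivlMr//.
    rewrite (_ : (lam * c = lam * (c - t y) + lam * t y)%R); last by ring.
    rewrite expRD mulrAC ler_pM2r ?expR_gt0// mulrC.
    by rewrite (le_trans _ (expR_ge1Dx _))// lerDr.
  by rewrite integral_cst// lee_wpmul2l// lee_fin divr_ge0// ltW.
apply: (le_trans (leeD hA hB)); rewrite -!EFinM -EFinD lee_fin.
rewrite -[(psi c / lam * N)%R]mulrA -mulrDr ler_wpM2l//.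
have : (lam^-1 * N <= 4^-1)%R by rewrite mulrC ler_pdivrMr// /lam; lra.
lra.
Qed.

(** Dominated convergence: the sets [t < p_ n] shrink to the empty set while
[rho] is integrable below [q]. *)
Lemma volterra_tail (rho : R -> R) (q : R) (p_ : nat -> R) :
  measurable_fun [set: R] rho ->
  (forall y, E y -> (t y < q)%R -> (0 <= rho (t y))%R) ->
  \int[mu]_(y in E `&` t @^-1` [set c | c < q]%R) (rho (t y))%:E < +oo ->
  (forall y, E y -> (t y < q)%R -> \forall n \near \oo, (p_ n <= t y)%R) ->
  exists n, \int[mu]_(y in E `&` t @^-1` [set c | c < q /\ c < p_ n]%R)
    (rho (t y))%:E <= (4^-1)%:E.
Proof.
move=> mrho rho0 rho_fin pt.
set D := _ `&` _ in rho_fin.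
have mD : measurable D by exact: lvl.
have mr : measurable_fun D (fun y => (rho (t y))%:E).
  apply/measurable_EFinP; apply: measurable_funS mE _ _; first by move=> y [].
  exact: measurableT_comp mrho mt.
have r0 y : D y -> 0 <= (rho (t y))%:E by move=> [Ey yq]; rewrite lee_fin rho0.
pose P n := E `&` t @^-1` [set c | c < q /\ c < p_ n]%R.
have mP n : measurable (P n).
  by apply: lvl; exact: (measurableI _ _ (mlt q) (mlt _)).
pose f_ n := (fun y => (rho (t y))%:E) \_ (P n).
have mf_ n : measurable_fun D (f_ n).
  apply/(measurable_restrict _ (mP n) mD).
  by apply: measurable_funS mr => // y [].
have cvf_ y : D y -> f_ ^~ y @ \oo --> 0.
  move=> [Ey yq]; apply: cvg_near_cst; near=> n.
  rewrite /f_ /patch ifF//; apply/negP; rewrite inE /P/= => -[_ [_]].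
  by apply/negP; rewrite -leNgt; near: n; exact: pt.
have ir : mu.-integrable D (fun y => (rho (t y))%:E).
  apply/integrableP; split => //.
  rewrite (_ : \int[mu]_(y in D) _ = \int[mu]_(y in D) (rho (t y))%:E)//.
  by apply: eq_integral => y /[!inE] Dy; rewrite gee0_abs ?r0.
have f_le y n : D y -> `|f_ n y| <= (rho (t y))%:E.
  move=> Dy; rewrite /f_ /patch; case: ifPn => _; last by rewrite abse0 r0.
  by rewrite gee0_abs ?r0.
have [_ _] := dominated_convergence mD mf_ (@measurable_cst _ _ _ _ D 0)
  (aeW mu cvf_) ir (aeW mu f_le).
rewrite integral0 => /fine_cvgP[fin_near] /cvgr0Pnorm_lt/(_ 4^-1%R)[|].
  by rewrite invr_gt0.
move=> n _ small; near \oo => m; exists m.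
have -> : \int[mu]_(y in E `&` t @^-1` [set c | c < q /\ c < p_ m]%R)
    (rho (t y))%:E = \int[mu]_(y in D) f_ m y.
  rewrite -[in RHS]integral_mkcondr; congr (integral _ _ _).
  by apply/seteqP; split => y /= => [[Ey [yq yp]]|[]].
rewrite -[leLHS]fineK; last by near: m.
rewrite lee_fin (le_trans (ler_norm _))//.
apply/ltW/small => /=; by near: m; exists n.
Unshelve. all: by end_near. Qed.

(** Since the contraction factor is 1/2, a multiple [psi] of the weight that
satisfies [phi <= psi / 2] is a supersolution. *)
Lemma volterra_supersolution (phi h rho : R -> R) (p_ : nat -> R) (q C : R) :
  (forall c, 0 <= h c)%R -> {homo h : c c' / (c <= c')%R} ->
  measurable_fun [set: R] rho ->
  (forall y, E y -> (t y < q)%R -> (0 <= rho (t y))%R) ->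
  (forall y c, E y -> (t y < c <= q)%R ->
     ((c - t y) * h (t y) <= rho (t y) * h c)%R) ->
  \int[mu]_(y in E `&` t @^-1` [set c | c < q]%R) (rho (t y))%:E < +oo ->
  (forall y, E y -> (t y < q)%R -> \forall n \near \oo, (p_ n <= t y)%R) ->
  (forall n, mu (E `&` t @^-1` [set c | c < q /\ p_ n <= c]%R) < +oo) ->
  (0 <= C)%R -> (forall c, (c <= q)%R -> (phi c <= C * h c)%R) ->
  exists2 psi : R -> R,
    measurable_fun [set: R] psi /\ (forall c, (0 <= psi c)%R) &
    forall c, (c <= q)%R ->
      (phi c)%:E + volterra (EFin \o psi) c <= (psi c)%:E.
Proof.
move=> h0 h_nd mrho rho0 hrho rho_fin pt mass C0 phiC.
have [n tail] := volterra_tail mrho rho0 rho_fin pt.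
pose B n := E `&` t @^-1` [set c | c < q /\ p_ n <= c]%R.
have [N NE] : exists N : R, mu (B n) = N%:E.
  by exists (fine (mu (B n))); rewrite fineK// ge0_fin_numE// mass.
have N0 : (0 <= N)%R by rewrite -lee_fin -NE.
pose lam := (4 * N + 1)%R.
have lam0 : (0 < lam)%R by rewrite /lam; lra.
(* The factor exp (- lam p) compensates the smallest value of the exponential
   weight, and 2 C makes the data at most half of the weight. *)
pose k := (2 * C * expR (- (lam * p_ n)))%R.
have k0 : (0 <= k)%R by rewrite !mulr_ge0 ?expR_ge0.
pose h' c := (k * h c)%R.
have h'0 c : (0 <= h' c)%R by rewrite mulr_ge0.
have h'_nd : {homo h' : c c' / (c <= c')%R}.
  by move=> c c' cc'; rewrite ler_wpM2l// h_nd.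
pose psi c := (h' c * expR (lam * Num.max c (p_ n)))%R.
have psi0 c : (0 <= psi c)%R by rewrite mulr_ge0 ?expR_ge0.
exists psi; first split => //.
  apply: nondecreasing_measurable => //.
  exact: weight_nondecreasing (ltW lam0) h'0 h'_nd.
move=> c cq.
have h'rho y c' : E y -> (t y < c' <= q)%R ->
    ((c' - t y) * h' (t y) <= rho (t y) * h' c')%R.
  by move=> Ey yc'; rewrite /h' mulrCA [leRHS]mulrCA ler_wpM2l// hrho.
have massN : mu (B n) <= N%:E by rewrite NE.
have Kpsi := weighted_volterra_le h'0 h'_nd mrho rho0 h'rho tail massN cq.
apply: (@le_trans _ _ ((psi c / 2)%:E + (psi c / 2)%:E)).
  apply: leeD Kpsi; rewrite lee_fin (le_trans (phiC _ cq))//.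
  rewrite /psi /h' /k (_ : (2 * C * expR (- (lam * p_ n)) * h c *
    expR (lam * Num.max c (p_ n)) / 2 = C * h c *
      (expR (- (lam * p_ n)) * expR (lam * Num.max c (p_ n))))%R); last by field.
  rewrite ler_peMr ?mulr_ge0// -expRD -mulrN -mulrDr.
  rewrite (le_trans _ (expR_ge1Dx _))// lerDl mulr_ge0 ?(ltW lam0)//.
  by rewrite addrC subr_ge0 le_max lexx orbT.
by rewrite -EFinD lee_fin -splitr.
Qed.

(** Markov's inequality. *)
Lemma integral_lty_measure (A : set T) (f : T -> R) (e : R) :
  measurable A -> measurable_fun A f -> (0 < e)%R ->
  (forall y, A y -> (e <= f y)%R) -> \int[mu]_(y in A) (f y)%:E < +oo ->
  mu A < +oo.
Proof.
move=> mA mf e0 ef.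
have : e%:E * mu A <= \int[mu]_(y in A) (f y)%:E.
  rewrite -integral_cst//; apply: ge0_le_integral => //.
  - by move=> y _; rewrite lee_fin ltW.
  - exact/measurable_EFinP.
move=> /le_lt_trans /[apply]; rewrite !ltey; apply: contra => /eqP ->.
by rewrite gt0_muley ?lte_fin.
Qed.

(** * Existence under the two integrability conditions *)

Hypothesis radon : forall x y, E x -> E y ->
  mu (E `&` t @^-1` [set c | t x <= c /\ c <= t y]%R) < +oo.

(** Below a level [q] the data are at most [phi q], so the weight is built on
[h = 1] and the kernel is at most [rho c = q - c].  The absence of a minimum of
[t] gives a level strictly below [t b], and Markov's inequality then shows that
[mu] is finite below every level; this is also what transports the
integrability condition from [b] to other points. *)
Lemma volterra_solution_bounded_data (phi : R -> R) (b : T) :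
  (forall c, (0 <= phi c)%R) -> {homo phi : c c' / (c <= c')%R} ->
  (forall x, E x -> exists2 x', E x' & (t x' < t x)%R) ->
  E b ->
  \int[mu]_(y in E `&` t @^-1` [set c | c <= t b]%R) (t b - t y)%:E < +oo ->
  has_volterra_solution phi.
Proof.
move=> phi0 phi_nd nomin Eb bfin.
have mtA (A : set T) (c : R) : A `<=` E ->
    measurable_fun A (fun y => (c - t y)%:E).
  move=> AE; apply/measurable_EFinP; apply: measurable_funB => //.
  exact: measurable_funS mt.
pose L (q : R) := E `&` t @^-1` [set c | c < q]%R.
have mL q : measurable (L q) by exact: lvl.
have L_fin x : E x -> mu (L (t x)) < +oo.
  move=> Ex; have [b' Eb' b'b] := nomin b Eb.
  pose A := E `&` t @^-1` [set c | c <= t b']%R.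
  have mA : measurable A by exact: lvl.
  have A_fin : mu A < +oo.
    apply: (@integral_lty_measure _ (fun y => t b - t y)%R (t b - t b')%R) => //.
    - by apply/measurable_EFinP; apply: mtA => y [].
    - by rewrite subr_gt0.
    - by move=> y [_ /= yb']; rewrite lerD2l lerN2.
    apply: le_lt_trans bfin; apply: ge0_subset_integral => //.
    - exact: lvl.
    - by apply: mtA => y [].
    - by move=> y [_ /= yb]; rewrite lee_fin subr_ge0.
    - by move=> y [Ey /= yb']; split => //=; rewrite (le_trans yb')// ltW.
  pose B := E `&` t @^-1` [set c | t b' <= c /\ c <= t x]%R.
  have mB : measurable B by apply: lvl; exact: (measurableI _ _ (mge _) (mle _)).
  apply: (@le_lt_trans _ _ (mu A + mu B)).
    apply: (@le_trans _ _ (mu (A `|` B))).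
      apply: le_measure; rewrite ?inE//; first exact: measurableU.
      move=> y [Ey /= yx]; case: (leP (t y) (t b')) => yb'; [left|right] => //.
      by split => //=; split; rewrite ltW.
    exact: measureU2.
  by apply: lte_add_pinfty => //; exact: radon.
apply: minimal_volterra_solution => // x Ex.
pose q := t x.
apply: (@volterra_supersolution phi (cst 1%R) (fun c => q - c)%R
  (fun n => - n%:R)%R q (phi q)) => //.
- exact: measurable_funB.
- by move=> y _ yq; rewrite subr_ge0 ltW.
- by move=> y c _ /andP[_ cq]; rewrite !mulr1 lerD2r.
- pose K := (`|q - t b|)%R.
  apply: (@le_lt_trans _ _ (\int[mu]_(y in L q)
      ((Num.max (t b - t y) 0)%:E + K%:E))).
    rewrite -/(L q); apply: ge0_le_integral => //.
    + by move=> y [_ /= yq]; rewrite lee_fin subr_ge0 ltW.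
    + by apply: (mtA _ q) => y [].
    + apply: emeasurable_funD => //.
      by apply: measurable_funS (measurable_volterra_kernel (t b)) => // y [].
    move=> y _; rewrite -EFinD lee_fin.
    rewrite (_ : (q - t y = (t b - t y) + (q - t b))%R); last by ring.
    by rewrite lerD ?ler_norm// le_max lexx.
  rewrite ge0_integralD//; last 3 first.
  + by move=> y _; rewrite volterra_kernel_ge0.
  + by apply: measurable_funS (measurable_volterra_kernel (t b)) => // y [].
  + by move=> y _; rewrite lee_fin normr_ge0.
  apply: lte_add_pinfty; last first.
    by rewrite integral_cst// lte_mul_pinfty// ?lee_fin ?normr_ge0// L_fin.
  apply: le_lt_trans bfin.
  apply: (@le_trans _ _ (\int[mu]_(y in E) (Num.max (t b - t y) 0)%:E)).
    apply: ge0_subset_integral => //; last by move=> y [].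
    + exact: measurable_volterra_kernel.
    + by move=> y _; exact: volterra_kernel_ge0.
  rewrite integral_mkcondr le_eqVlt; apply/orP; left; apply/eqP.
  apply: eq_integral => y _; rewrite /patch; case: ifPn.
    by rewrite inE /= => yb; rewrite max_l// subr_ge0.
  rewrite notin_setE /= => /negP; rewrite -ltNge => /ltW yb.
  by rewrite max_r// subr_le0.
- move=> y _ _; near=> n.
  rewrite lerNl (le_trans (ler_norm _))// normrN.
  by near: n; exact: nbhs_infty_ger.
- move=> n; apply: le_lt_trans (L_fin x Ex); apply: le_measure; rewrite ?inE//.
  + by apply: lvl; exact: (measurableI _ _ (mlt _) (mge _)).
  + by move=> y [Ey [/= yq _]].
- by move=> c cq; rewrite mulr1 phi_nd.
Unshelve. all: by end_near. Qed.

(** The measure may be infinite near the lower end, where only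
[t y - theta] is integrable; this is compensated by data which vanish there.
With [h c = (c - theta)^+], the inequality
[(c - t y) * (t y - theta) <= (t y - theta) * (c - theta)] gives
[rho c = c - theta], and levels approaching [theta] from above serve as [p]. *)
Lemma volterra_solution_linear_data (theta kappa : R) (b : T) :
  (0 <= kappa)%R -> (forall x, E x -> (theta < t x)%R) -> E b ->
  \int[mu]_(y in E `&` t @^-1` [set c | c <= t b]%R) (t y - theta)%:E < +oo ->
  has_volterra_solution (fun c => kappa * Num.max (c - theta) 0)%R.
Proof.
move=> kappa0 theta_lt Eb bfin.
have mtA (A : set T) : A `<=` E -> measurable_fun A (fun y => (t y - theta)%:E).
  move=> AE; apply/measurable_EFinP; apply: measurable_funB => //.
  exact: measurable_funS mt.
have h_nd : {homo (fun c => Num.max (c - theta) 0)%R : c c' / (c <= c')%R}.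
  by move=> c c' cc'; rewrite ge_max !le_max lexx !orbT lerD2r cc'.
have h0 c : (0 <= Num.max (c - theta) 0)%R by rewrite le_max lexx orbT.
have r0 y : E y -> 0 <= (t y - theta)%:E.
  by move=> Ey; rewrite lee_fin subr_ge0 ltW// theta_lt.
apply: minimal_volterra_solution.
- by move=> c; rewrite mulr_ge0.
- by move=> c c' cc'; rewrite ler_wpM2l// h_nd.
move=> x Ex; pose q := t x.
pose L := E `&` t @^-1` [set c | c < q]%R.
have mL : measurable L by exact: lvl.
have L_fin : \int[mu]_(y in L) (t y - theta)%:E < +oo.
  pose A := E `&` t @^-1` [set c | c <= t b]%R.
  pose B := E `&` t @^-1` [set c | t b < c /\ c <= q]%R.
  have mA : measurable A by exact: lvl.
  have mB : measurable B by apply: lvl; exact: (measurableI _ _ (mgt _) (mle _)).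
  have ABE : A `|` B `<=` E by move=> y [] [].
  apply: (@le_lt_trans _ _ (\int[mu]_(y in A `|` B) (t y - theta)%:E)).
    apply: ge0_subset_integral => //.
    - exact: measurableU.
    - exact: mtA.
    - by move=> y /ABE; exact: r0.
    move=> y [Ey /= yq]; case: (leP (t y) (t b)) => yb; [left|right] => //.
    by split => //=; split => //; rewrite ltW.
  rewrite ge0_integral_setU//; last 3 first.
  - exact: mtA.
  - by move=> y /ABE; exact: r0.
  - apply/disj_setPS => y [[_ /= yb] [_ [/= by_ _]]].
    by move: (le_lt_trans yb by_); rewrite ltxx.
  apply: lte_add_pinfty => //.
  apply: (@le_lt_trans _ _ (\int[mu]_(y in B) cst ((q - theta)%:E) y)).
    apply: ge0_le_integral => //.
    - by move=> y [Ey _]; exact: r0.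
    - by apply: mtA => y [].
    - by move=> y [Ey [_ /= yq]]; rewrite lee_fin lerD2r.
  rewrite integral_cst// lte_mul_pinfty//.
    by rewrite lee_fin subr_ge0 ltW// theta_lt.
  apply: le_lt_trans (radon Eb Ex); apply: le_measure; rewrite ?inE//.
    by apply: lvl; exact: (measurableI _ _ (mge _) (mle _)).
  by move=> y [Ey [/= yb yq]]; split => //=; rewrite ltW.
apply: (@volterra_supersolution _ (fun c => Num.max (c - theta) 0)%R
  (fun c => c - theta)%R (fun n => theta + n.+1%:R^-1)%R q kappa) => //.
- exact: measurable_funB.
- by move=> y Ey _; rewrite subr_ge0 ltW// theta_lt.
- move=> y c Ey /andP[yc _]; have := theta_lt y Ey => yt.
  have ct : (theta < c)%R := lt_trans yt yc.
  rewrite !max_l ?subr_ge0 ?(ltW yt) ?(ltW ct)// mulrC.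
  by rewrite ler_wpM2l ?subr_ge0 ?(ltW yt)// lerD2l lerN2 ltW.
- move=> y Ey _; have yt : (0 < t y - theta)%R by rewrite subr_gt0 theta_lt.
  near=> n; rewrite -lerBrDl ltW//.
  by near: n; exact: (near_infty_natSinv_lt (PosNum yt)).
- move=> n; set P := _ `&` _.
  have mP : measurable P by apply: lvl; exact: (measurableI _ _ (mlt _) (mge _)).
  apply: (@integral_lty_measure _ (fun y => t y - theta)%R n.+1%:R^-1) => //.
  + by apply/measurable_EFinP; apply: mtA => y [].
  + by move=> y [Ey [/= _ py]]; rewrite lerBrDl.
  apply: le_lt_trans L_fin; apply: ge0_subset_integral => //.
  + by apply: mtA => y [].
  + by move=> y [Ey _]; exact: r0.
  + by move=> y [Ey [/= yq _]].
Unshelve. all: by end_near. Qed.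

End volterra.

(** * State space and scale function *)

Section scale_function.
Context (R : realType) (l r : \bar R).
Let E := state_space l r.

Lemma is_interval_state_space : is_interval E.
Proof.
move=> x y [lx _] [_ yr] z /andP[xz zy]; split.
- by rewrite (lt_le_trans lx)// lee_fin.
- by rewrite (le_lt_trans _ yr)// lee_fin.
Qed.

Lemma measurable_state_space : measurable (E : set (measurableTypeR R)).
Proof. by apply: is_interval_measurable; exact: is_interval_state_space. Qed.

Lemma state_space_lt_left (x : R) : E x -> exists2 y, E y & y < x.
Proof.
move=> [lx xr].
have [y ly yx] : exists2 y : R, (l < y%:E)%E & y < x.
  case: l lx => [a| |] // => [|_]; last first.
    by exists (x - 1); rewrite ?ltNyr// gtrDl oppr_lt0.
  by rewrite lte_fin => ax; exists ((a + x) / 2); rewrite ?lte_fin; lra.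
by exists y => //; split => //; rewrite (lt_trans _ xr)// lte_fin.
Qed.

Lemma state_space_lt_right (x : R) : E x -> exists2 y, E y & x < y.
Proof.
move=> [lx xr].
have [y yr xy] : exists2 y : R, (y%:E < r)%E & x < y.
  case: r xr => [a| |] // => [|_]; last first.
    by exists (x + 1); rewrite ?ltry// ltrDl.
  by rewrite lte_fin => ax; exists ((a + x) / 2); rewrite ?lte_fin; lra.
by exists y => //; split => //; rewrite (lt_trans lx)// lte_fin.
Qed.

Lemma near_left_end_proper : ProperFilter (near_left_end l).
Proof. by case: l => [a| |]; rewrite /near_left_end; exact _. Qed.

Lemma near_right_end_proper : ProperFilter (near_right_end r).
Proof. by case: r => [a| |]; rewrite /near_right_end; exact _. Qed.

Lemma near_left_end_lt (x : R) : E x ->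
  \forall y \near near_left_end l, E y /\ y < x.
Proof.
move=> [lx xr].
have : \forall y \near near_left_end l, (l < y%:E)%E /\ y < x.
  case: l lx => [a| |] /= ax.
  - near=> y; rewrite lte_fin; split; near: y; first exact: nbhs_right_gt.
    by apply: nbhs_right_lt; rewrite -lte_fin.
  - by move: ax; rewrite ltNge leey.
  - have : \forall y \near ninfty_nbhs R, y < x.
      by apply: nbhs_ninfty_lt; exact: num_real.
    by apply: filterS => y yx; rewrite ltNyr.
have F := near_left_end_proper.
apply: filterS => y [ly yx]; split => //; split => //.
by rewrite (lt_trans _ xr)// lte_fin.
Unshelve. all: by end_near. Qed.

Lemma near_right_end_gt (x : R) : E x ->
  \forall y \near near_right_end r, E y /\ x < y.
Proof.
move=> [lx xr].
have : \forall y \near near_right_end r, (y%:E < r)%E /\ x < y.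
  case: r xr => [a| |] /= xa.
  - near=> y; rewrite lte_fin; split; near: y; first exact: nbhs_left_lt.
    by apply: nbhs_left_gt; rewrite -lte_fin.
  - have : \forall y \near pinfty_nbhs R, x < y.
      by apply: nbhs_pinfty_gt; exact: num_real.
    by apply: filterS => y xy; rewrite ltry.
  - by move: xa; rewrite ltNge leNye.
have F := near_right_end_proper.
apply: filterS => y [yr xy]; split => //; split => //.
by rewrite (lt_trans lx)// lte_fin.
Unshelve. all: by end_near. Qed.

(** Applied to [s] at the left end and to [- s] at the right end: it identifies
the limits that define the scale at the endpoints, and shows that these values
are not attained, which the data vanishing at an endpoint rely on. *)
Lemma cvg_to_ereal_inf (F : set_system R) (t : R -> R) (A : set R) :
  ProperFilter F -> A !=set0 ->
  (forall x, A x -> \forall y \near F, A y /\ t y < t x) ->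
  ((t y)%:E @[y --> F] --> ereal_inf [set (t x)%:E | x in A])%E /\
  forall x, A x -> (ereal_inf [set (t x)%:E | x in A] < (t x)%:E)%E.
Proof.
move=> PF [x0 Ax0] At; set I := ereal_inf _.
have Ile x : A x -> (I <= (t x)%:E)%E.
  by move=> Ax; apply: ereal_inf_lbound; exists x.
have below (b : R) : (I < b%:E)%E -> \forall y \near F, A y /\ t y < b.
  move=> /ereal_inf_lt[_ [x Ax <-]]; rewrite lte_fin => xb.
  by apply: filterS (At x Ax) => y [Ay yx]; split => //; exact: lt_trans xb.
split; last first.
  move=> x Ax; have [y [Ay yx]] := filter_ex (At x Ax).
  by rewrite (le_lt_trans (Ile _ Ay))// lte_fin.
case: I Ile below => [i| |] Ile below.
- apply: cvg_EFin; first exact: nearW.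
  apply/cvgrPdist_lt => e e0; near=> y.
  have [Ay yi] : A y /\ t y < i + e.
    by near: y; apply: below; rewrite lte_fin ltrDl.
  have := Ile _ Ay; rewrite lee_fin => iy.
  by rewrite /= distrC ger0_norm ?subr_ge0// ltrBlDl.
- by have := Ile _ Ax0; rewrite leye_eq.
- apply/cvgeNyPle => b; near=> y.
  have [Ay yb] : A y /\ t y < b by near: y; apply: below; rewrite ltNyr.
  by rewrite lee_fin ltW.
Unshelve. all: by end_near. Qed.

Variable s : R -> R.
Hypotheses (hs : is_scale_function l r s).
Implicit Types x y : R.

Lemma scale_lt x y : E x -> E y -> (s x < s y) = (x < y).
Proof.
move=> Ex Ey; have [s_incr _] := hs.
have homo a b : E a -> E b -> a < b -> s a < s b.
  by move=> Ea Eb; apply: s_incr; rewrite inE.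
apply/idP/idP; last exact: homo.
apply: contraTT; rewrite -!leNgt le_eqVlt => /predU1P[->//|/homo yx].
by rewrite ltW// yx.
Qed.

Lemma scale_le x y : E x -> E y -> (s x <= s y) = (x <= y).
Proof. by move=> Ex Ey; rewrite !leNgt scale_lt. Qed.

Lemma measurable_scale : measurable_fun (E : set (measurableTypeR R)) s.
Proof.
apply: (measurability (@RGenCInfty.G R)) => [|/= _ [_] [c] -> <-].
  exact: RGenCInfty.measurableE.
apply: is_interval_measurable => x y /=.
rewrite !in_itv/= !andbT => -[Ex cx] [Ey _] z /andP[xz zy].
have Ez : E z by apply: (is_interval_state_space Ex Ey); rewrite xz.
by split => //; rewrite in_itv/= andbT (le_trans cx)// scale_le.
Qed.

Lemma scale_left_lt x : E x -> (scale_left l s < (s x)%:E)%E.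
Proof.
move=> Ex; have PF := near_left_end_proper.
have near_lt z : E z -> \forall y \near near_left_end l, E y /\ s y < s z.
  move=> Ez; apply: filterS (near_left_end_lt Ez) => y [Ey yz].
  by rewrite scale_lt.
have [cvgI Ilt] := cvg_to_ereal_inf PF (ex_intro _ x Ex) near_lt.
by rewrite /scale_left (cvg_lim _ cvgI)// Ilt.
Qed.

Lemma scale_right_gt x : E x -> ((s x)%:E < scale_right r s)%E.
Proof.
move=> Ex; have PF := near_right_end_proper.
have near_lt z : E z -> \forall y \near near_right_end r, E y /\ - s y < - s z.
  move=> Ez; apply: filterS (near_right_end_gt Ez) => y [Ey yz].
  by rewrite ltrN2 scale_lt.
have [cvgI Ilt] := cvg_to_ereal_inf PF (ex_intro _ x Ex) near_lt.
move: cvgI => /cvgeN cvgNI; rewrite /scale_right.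
under eq_fun do rewrite -[s _]opprK EFinN.
by rewrite (cvg_lim _ cvgNI)// lteNr -EFinN Ilt.
Qed.

Variable mu : {measure set (measurableTypeR R) -> \bar R}.
Hypothesis hmu : is_radon l r mu.

(** * The two equations as Volterra equations *)

Lemma radon_segment x y : E x -> E y -> (mu `[x, y]%classic < +oo)%E.
Proof.
move=> Ex Ey; apply: hmu; first exact: segment_compact.
move=> z /=; rewrite in_itv/= => xzy; exact: is_interval_state_space xzy.
Qed.

Lemma radon_scale x y : E x -> E y ->
  (mu (E `&` s @^-1` [set c | s x <= c /\ c <= s y]%R) < +oo)%E.
Proof.
move=> Ex Ey; rewrite (_ : _ `&` _ = `[x, y]%classic) ?radon_segment//.
apply/seteqP; split => z /=; rewrite in_itv/=.
  by move=> [Ez]; rewrite !scale_le// => -[-> ->].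
move=> xzy; have Ez : E z by exact: (is_interval_state_space Ex Ey).
by rewrite !scale_le//; move/andP: xzy.
Qed.

Lemma radon_scaleN x y : E x -> E y ->
  (mu (E `&` (fun z => - s z)%R @^-1` [set c | - s x <= c /\ c <= - s y]%R)
    < +oo)%E.
Proof.
move=> Ex Ey; apply: le_lt_trans (radon_scale Ey Ex).
rewrite (_ : _ `&` (fun z => - s z) @^-1` _ =
  E `&` s @^-1` [set c | s y <= c /\ c <= s x])//.
by apply/seteqP; split => z /=; rewrite !lerN2 => -[Ez []].
Qed.

Lemma nondecreasing_solution_I (a kappa : R) (phi : R -> R) :
  (forall x, E x -> (a%:E + kappa%:E * ((s x)%:E - scale_left l s))%E =
    (phi (s x))%:E) ->
  has_volterra_solution mu E s phi ->
  has_nonneg_nondecreasing_solution_I l r s mu a kappa.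
Proof.
move=> phiE [g [gsol g0 g_nd]]; exists g; split.
- by move=> x /[!inE] Ex; rewrite phiE//; exact: gsol.
- by move=> x /[!inE]; exact: g0.
- by move=> x y /[!inE] Ex Ey xy; apply: g_nd => //; rewrite scale_le.
Qed.

(** With [t = - s] the kernel [(t x - t y)^+] is [(s y - s x)^+], and the lower
end of [t] corresponds to the right end of the state space. *)
Lemma nonincreasing_solution_II (a kappa : R) (phi : R -> R) :
  (forall x, E x -> (a%:E + kappa%:E * (scale_right r s - (s x)%:E))%E =
    (phi (- s x))%:E) ->
  has_volterra_solution mu E (fun y => - s y) phi ->
  has_nonneg_nonincreasing_solution_II l r s mu a kappa.
Proof.
move=> phiE [g [gsol g0 g_nd]]; exists g; split.
- move=> x /[!inE] Ex; rewrite phiE//.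
  have [] := gsol x Ex.
  by under eq_fun do rewrite opprK addrC.
- by move=> x /[!inE]; exact: g0.
- by move=> x y /[!inE] Ex Ey xy; apply: g_nd => //; rewrite lerN2 scale_le.
Qed.

End scale_function.

Unset Implicit Arguments.

Theorem theorem5p1 (R : realType) (l r : \bar R) (hlr : (l < r)%E)
    (s : R -> R) (hs : is_scale_function l r s)
    (mu : {measure set (measurableTypeR R) -> \bar R})
    (hmu : is_radon l r mu) (hmu_pos : (0 < mu (state_space l r))%E) :
  (* (1) *)
  ((exists2 b : R, b \in state_space l r &
      (\int[mu]_(y in state_space l r `&` [set y | (y <= b)%R])
         (s b - s y)%:E < +oo)%E) ->
    (forall a : R, 0 < a ->
       has_nonneg_nondecreasing_solution_I l r s mu a 0) /\
    (scale_left l s \is a fin_num -> forall a kappa : R, 0 < a -> 0 < kappa ->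
       has_nonneg_nondecreasing_solution_I l r s mu a kappa)) /\
  ((exists2 b : R, b \in state_space l r &
      (\int[mu]_(y in state_space l r `&` [set y | (b <= y)%R])
         (s y - s b)%:E < +oo)%E) ->
    (forall a : R, 0 < a ->
       has_nonneg_nonincreasing_solution_II l r s mu a 0) /\
    (scale_right r s \is a fin_num -> forall a kappa : R, 0 < a -> 0 < kappa ->
       has_nonneg_nonincreasing_solution_II l r s mu a kappa)) /\
  (* (2) *)
  (scale_left l s \is a fin_num ->
    (exists2 b : R, b \in state_space l r &
      (\int[mu]_(y in state_space l r `&` [set y | (y <= b)%R])
         ((s y)%:E - scale_left l s) < +oo)%E) ->
    forall kappa : R, 0 < kappa ->
      has_nonneg_nondecreasing_solution_I l r s mu 0 kappa) /\
  (scale_right r s \is a fin_num ->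
    (exists2 b : R, b \in state_space l r &
      (\int[mu]_(y in state_space l r `&` [set y | (b <= y)%R])
         (scale_right r s - (s y)%:E) < +oo)%E) ->
    forall kappa : R, 0 < kappa ->
      has_nonneg_nonincreasing_solution_II l r s mu 0 kappa).
Proof.
have mE := measurable_state_space l r.
have ms := measurable_scale hs.
have msN : measurable_fun (state_space l r : set (measurableTypeR R))
    (fun y => - s y) by exact: measurable_funN.
have radon := radon_scale hs hmu; have radonN := radon_scaleN hs hmu.
have nomin x : state_space l r x ->
    exists2 x', state_space l r x' & s x' < s x.
  move=> Ex; have [x' Ex' x'x] := state_space_lt_left Ex.
  by exists x' => //; rewrite (scale_lt hs).
have nominN x : state_space l r x ->
    exists2 x', state_space l r x' & - s x' < - s x.
  move=> Ex; have [x' Ex' xx'] := state_space_lt_right Ex.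
  by exists x' => //; rewrite ltrN2 (scale_lt hs).
have below b : state_space l r b -> state_space l r `&` [set y | y <= b] =
    state_space l r `&` s @^-1` [set c | c <= s b].
  move=> Eb; apply/seteqP; split => y /= [Ey].
    by rewrite (scale_le hs).
  by rewrite (scale_le hs).
have above b : state_space l r b -> state_space l r `&` [set y | b <= y] =
    state_space l r `&` (fun y => - s y) @^-1` [set c | c <= - s b].
  move=> Eb; apply/seteqP; split => y /= [Ey].
    by rewrite lerN2 (scale_le hs).
  by rewrite lerN2 (scale_le hs).
have phi_ge0 (a kappa theta c : R) : 0 < a -> 0 <= kappa ->
    0 <= a + kappa * Num.max (c - theta) 0.
  by move=> a0 k0; rewrite addr_ge0 ?(ltW a0)// mulr_ge0// le_max lexx orbT.
have phi_nd (a kappa theta : R) : 0 <= kappa ->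
    {homo (fun c => a + kappa * Num.max (c - theta) 0) : c c' / c <= c'}.
  move=> k0 c c' cc'; rewrite lerD2l ler_wpM2l//.
  by rewrite ge_max !le_max lexx !orbT lerD2r cc'.
have leftE (a kappa : R) : scale_left l s \is a fin_num -> forall x,
    state_space l r x ->
    (a%:E + kappa%:E * ((s x)%:E - scale_left l s))%E =
    (a + kappa * Num.max (s x - fine (scale_left l s)) 0)%:E.
  move=> fin x /(scale_left_lt hs); rewrite -{1 2}(fineK fin) lte_fin => slt.
  by rewrite max_l// subr_ge0 ltW.
have rightE (a kappa : R) : scale_right r s \is a fin_num -> forall x,
    state_space l r x ->
    (a%:E + kappa%:E * (scale_right r s - (s x)%:E))%E =
    (a + kappa * Num.max (- s x - - fine (scale_right r s)) 0)%:E.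
  move=> fin x /(scale_right_gt hs); rewrite -{1 2}(fineK fin) lte_fin => slt.
  by rewrite opprK [(- s x + _)%R]addrC max_l// subr_ge0 ltW.
split; last split; last split.
- move=> [b /[!inE] Eb]; rewrite below// => bfin.
  split => [a a0|fin a kappa a0 kappa0].
    apply: (nondecreasing_solution_I hs (phi := cst a)).
      by move=> x _; rewrite mul0e adde0.
    apply: (volterra_solution_bounded_data mE ms radon _ _ nomin Eb bfin) => //.
    by move=> c; exact: ltW.
  pose phi (c : R) := a + kappa * Num.max (c - fine (scale_left l s)) 0.
  apply: (nondecreasing_solution_I hs (phi := phi) (leftE a kappa fin)).
  apply: (volterra_solution_bounded_data mE ms radon _ _ nomin Eb bfin).
    by move=> c; apply: phi_ge0 => //; exact: ltW.
  exact: (phi_nd a kappa _ (ltW kappa0)).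
- move=> [b /[!inE] Eb]; rewrite above//.
  rewrite (eq_integral (fun y : measurableTypeR R => (- s b - - s y)%:E)); last first.
    by move=> y _; rewrite opprK addrC.
  move=> bfin; split => [a a0|fin a kappa a0 kappa0].
    apply: (nonincreasing_solution_II hs (phi := cst a)).
      by move=> x _; rewrite mul0e adde0.
    apply: (volterra_solution_bounded_data mE msN radonN _ _ nominN Eb bfin) => //.
    by move=> c; exact: ltW.
  pose phi (c : R) := a + kappa * Num.max (c - - fine (scale_right r s)) 0.
  apply: (nonincreasing_solution_II hs (phi := phi) (rightE a kappa fin)).
  apply: (volterra_solution_bounded_data mE msN radonN _ _ nominN Eb bfin).
    by move=> c; apply: phi_ge0 => //; exact: ltW.
  exact: (phi_nd a kappa _ (ltW kappa0)).
- move=> fin [b /[!inE] Eb]; rewrite below// -(fineK fin) => bfin kappa kappa0.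
  apply: (nondecreasing_solution_I hs (phi := fun c =>
    kappa * Num.max (c - fine (scale_left l s)) 0)).
    by move=> x Ex; rewrite leftE// add0r.
  apply: (volterra_solution_linear_data mE ms radon (ltW kappa0) _ Eb bfin).
  by move=> x /(scale_left_lt hs); rewrite -{1}(fineK fin) lte_fin.
- move=> fin [b /[!inE] Eb]; rewrite above// -(fineK fin).
  rewrite (eq_integral (fun y : measurableTypeR R => (- s y - - fine (scale_right r s))%:E)); last first.
    by move=> y _; rewrite opprK addrC.
  move=> bfin kappa kappa0.
  apply: (nonincreasing_solution_II hs (phi := fun c =>
    kappa * Num.max (c - - fine (scale_right r s)) 0)).
    by move=> x Ex; rewrite rightE// add0r.
  apply: (volterra_solution_linear_data mE msN radonN (ltW kappa0) _ Eb bfin).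
  by move=> x /(scale_right_gt hs); rewrite -{1}(fineK fin) lte_fin ltrN2.
Qed.
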